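(* Let $\tau>0$, $\gamma>0$ and let $\tilde E$ be a symmetric positive definite matrix of the same size as $E=Z^TAZ$. With the setting and notation of the context (symmetric positive definite $A\in\mathbb{R}^{n\times n}$, overlapping decomposition into $N$ subdomains, near-kernel subspace $G$, arbitrary symmetric positive definite local matrices $B_i$, coarse space $V_0=V_G+V^\tau_{geneo}+V^\gamma_{geneo}$ with basis matrix $Z$, projections $\xi_{0i}$ and $\eta_i$), put $\tilde P_0:=Z\tilde E^{-1}Z^TA$ and define the SORAS with GenEO preconditioner with inexact coarse solves $$\tilde M^{-1}_{SORAS,2}:=\tilde P_0A^{-1}+(I-\tilde P_0)\sum_{i=1}^N R_i^TD_i(I-\eta_i)(I-\xi_{0i})B_i^{-1}D_iR_i\,(I-\tilde P_0^T).$$ Let $\lambda_+:=\lambda_{max}(E\tilde E^{-1})$, $\lambda_-:=\lambda_{min}(E\tilde E^{-1})$ and $\epsilon_A:=\max(|1-\lambda_-|,|1-\lambda_+|)$. Then for all $\mathbf U\in\mathbb{R}^n$ $$c_T\,a(\mathbf U,\mathbf U)\le a\big(\tilde M^{-1}_{SORAS,2}A\mathbf U,\mathbf U\big)\le c_R\,a(\mathbf U,\mathbf U),$$ where $$c_R=\frac{k_0\gamma(1+\epsilon_A^2)+\lambda_++\sqrt{\big(k_0\gamma(1+\epsilon_A^2)-\lambda_+\big)^2+4\lambda_+k_0\gamma\epsilon_A^2}}{2},\qquad c_T=\frac{\lambda_-}{(1+\epsilon_A\sqrt{k_0k_1\tau\gamma})^2+\lambda_-k_1\tau}.$$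
   Context: All scalar products $(\cdot,\cdot)$ are Euclidean. $A\in\mathbb{R}^{n\times n}$ is a symmetric positive definite (SPD) matrix arising from a conforming finite element discretisation of a symmetric coercive bilinear form $a$ on a domain $\Omega$; write $a(\mathbf U,\mathbf V)=(A\mathbf U,\mathbf V)$. The form is a sum over mesh elements, $a=\sum_{K} a_K$, with each $a_K$ a symmetric positive semidefinite bilinear form on $\mathbb{R}^n$. $\Omega$ is covered by $N$ overlapping subdomains $\Omega_i$, each a union of mesh elements. $R_i\in\mathbb{R}^{n_i\times n}$ is the Boolean restriction matrix selecting the $n_i$ degrees of freedom of $\Omega_i$. $D_i\in\mathbb{R}^{n_i\times n_i}$ are diagonal matrices forming a partition of unity: $\sum_{i=1}^N R_i^TD_iR_i=I$. The local Neumann matrix $A_i^{Neu}\in\mathbb{R}^{n_i\times n_i}$ is defined by $(A_i^{Neu}R_i\mathbf U,R_i\mathbf V)=\sum_{K\subset\Omega_i}a_K(\mathbf U,\mathbf V)$ for all $\mathbf U,\mathbf V\in\mathbb{R}^n$ (the right side depends only on $R_i\mathbf U,R_i\mathbf V$), and is assumed SPD. $k_0:=\max_{1\le i\le N}\#\{j : R_jAR_i^T\neq 0\}$ is the maximal number of neighbours of a subdomain (including itself). $k_1$ is the maximal multiplicity of subdomain intersections, i.e. the largest number of subdomains sharing a common mesh element. $G\subset\mathbb{R}^n$ is a given subspace (the near-kernel of $A$), $G_i:=R_iG\subset\mathbb{R}^{n_i}$, and $V_G:=\sum_{i=1}^N R_i^TD_iG_i\subset\mathbb{R}^n$. For each $i$,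 $B_i\in\mathbb{R}^{n_i\times n_i}$ is a given SPD matrix, $G_i^{\perp_{B_i}}:=\{\mathbf U_i\in\mathbb{R}^{n_i}: (B_i\mathbf U_i,\mathbf V_i)=0\ \forall\,\mathbf V_i\in G_i\}$, and $\xi_{0i}$ is the $B_i$-orthogonal projection of $\mathbb{R}^{n_i}$ onto $G_i$ (parallel to $G_i^{\perp_{B_i}}$). GenEO coarse spaces. (i) For each $1\le j\le N$, let $(\mathbf V_{jk})_k$ be a basis of $\mathbb{R}^{n_j}$ of eigenvectors, with eigenvalues $\lambda_{jk}\in\mathbb{R}$, of $$(I-\xi_{0j}^T)B_j(I-\xi_{0j})\mathbf V_{jk}=\lambda_{jk}A_j^{Neu}\mathbf V_{jk}.$$ $V^\tau_{geneo}\subset\mathbb{R}^n$ is the span of all vectors $R_j^TD_j(I-\xi_{0j})\mathbf V_{jk}$ with $1\le j\le N$, $\lambda_{jk}>\tau$. (ii) For each $1\le i\le N$, let $(\mathbf U_{ik})_k$ be a basis of $G_i^{\perp_{B_i}}$ of eigenvectors, with eigenvalues $\mu_{ik}\in\mathbb{R}$, of the problem $$(D_iR_iAR_i^TD_i\mathbf U_{ik},\mathbf W)=\mu_{ik}(B_i\mathbf U_{ik},\mathbf W)\qquad\forall\,\mathbf W\in G_i^{\perp_{B_i}}.$$ $V^\gamma_{geneo}\subset\mathbb{R}^n$ is the span of all vectors $R_i^TD_i\mathbf U_{ik}$ with $1\le i\le N$, $\mu_{ik}>\gamma$. Moreover $\eta_i$ is the ($B_i$-orthogonal) projection from $G_i^{\perp_{B_i}}$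 onto $\mathrm{span}\{\mathbf U_{ik}: \mu_{ik}>\gamma\}$ parallel to $W_{i,\gamma}:=\mathrm{span}\{\mathbf U_{ik}: \mu_{ik}\le\gamma\}$. The coarse space is $V_0:=V_G+V^\tau_{geneo}+V^\gamma_{geneo}$, and $Z$ is a full-column-rank matrix whose columns form a basis of $V_0$; $E:=Z^TAZ$ is the exact coarse matrix. $\lambda_{max}(E\tilde E^{-1})$ and $\lambda_{min}(E\tilde E^{-1})$ denote the largest and smallest eigenvalues of $E\tilde E^{-1}$ (all of which are real and positive). *)

(* Defs.v *)
From HB Require Import structures.
From mathcomp Require Import all_boot all_order all_algebra.
From mathcomp Require Import reals.

Set Implicit Arguments.
Unset Strict Implicit.
Unset Printing Implicit Defensive.

Import Order.TTheory GRing.Theory Num.Theory.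
Local Open Scope ring_scope.

Section Euclidean.
Variable R : realType.

Definition dot n (u v : 'cV[R]_n) : R := (u^T *m v) 0 0.

Definition spd n (M : 'M[R]_n) : Prop :=
  M^T = M /\ forall u : 'cV[R]_n, u != 0 -> 0 < dot (M *m u) u.

Definition mximage m n (M : 'M[R]_(m, n)) (S : {vspace 'cV[R]_n}) :
  {vspace 'cV[R]_m} := (linfun (mulmx M : 'cV_n -> 'cV_m) @: S)%VS.

Lemma mximageP m n (M : 'M[R]_(m, n)) (S : {vspace 'cV[R]_n}) (y : 'cV[R]_m) :
  reflect (exists2 x, x \in S & y = M *m x) (y \in mximage M S).
Proof.
by apply: (iffP memv_imgP) => -[x xS ->]; exists x; rewrite ?lfunE.
Qed.

(* Since (B u, v) = v^T B u by definition of [dot], this is the subspace of the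
   u such that (B u, v) = 0 for all v in S; see [orthvP]. *)
Definition orthv n (B : 'M[R]_n) (S : {vspace 'cV[R]_n}) : {vspace 'cV[R]_n} :=
  (\bigcap_(v <- vbasis S)
     lker (linfun (mulmx (v^T *m B) : 'cV_n -> 'cV_1)))%VS.

Lemma orthvP n (B : 'M[R]_n) (S : {vspace 'cV[R]_n}) (u : 'cV[R]_n) :
  reflect (forall v, v \in S -> dot (B *m u) v = 0) (u \in orthv B S).
Proof.
have dotE v : dot (B *m u) v = (v^T *m B *m u) 0 0.
  rewrite /dot.
  have -> : (B *m u)^T *m v = (v^T *m B *m u)^T.
    by rewrite !trmx_mul trmxK mulmxA.
  by rewrite mxE.
have mem_cap (s : seq 'cV[R]_n) :
    (u \in (\bigcap_(v <- s)
       lker (linfun (mulmx (v^T *m B) : 'cV_n -> 'cV_1)))%VS)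
    = all (fun v => dot (B *m u) v == 0) s.
  elim: s => [|v s IHs] /=; first by rewrite big_nil memvf.
  rewrite big_cons memv_cap IHs memv_ker lfunE /= dotE; congr (_ && _).
  apply/eqP/eqP => [->|h]; first by rewrite mxE.
  by apply/matrixP => i j; rewrite !ord1 h mxE.
rewrite /orthv mem_cap; apply: (iffP allP) => [h v vS|h v vS]; last first.
  by apply/eqP/h/vbasis_mem.
rewrite (coord_vbasis vS) /dot mulmx_sumr summxE big1 // => i _.
rewrite -scalemxAr mxE.
have /h/eqP : (vbasis S)`_i \in vbasis S by rewrite mem_nth ?size_tuple.
by rewrite /dot => ->; rewrite mulr0.
Qed.

(* P acts on D as the projection onto S parallel to T, where D is the direct
   sum of S and T; the values of P outside D are not constrained. *)
Definition projection_on n (D S T : {vspace 'cV[R]_n}) (P : 'M[R]_n) : Prop :=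
  forall u, u \in D -> P *m u \in S /\ u - P *m u \in T.

(* The rows of a restriction matrix list the degrees of freedom in S, each of
   them once, in an arbitrary order. *)
Definition restriction_mx n d (S : {set 'I_n}) (Rm : 'M[R]_(d, n)) : Prop :=
  exists s : 'I_d -> 'I_n,
    [/\ injective s, [set s p | p : 'I_d] = S
      & Rm = \matrix_(p, q) (s p == q)%:R].

(* [eigenvalue] refers to left eigenvectors, which give the same spectrum as
   right ones. *)
Definition largest_eigenvalue n (M : 'M[R]_n) (l : R) : Prop :=
  eigenvalue M l /\ forall x, eigenvalue M x -> x <= l.

Definition smallest_eigenvalue n (M : 'M[R]_n) (l : R) : Prop :=
  eigenvalue M l /\ forall x, eigenvalue M x -> l <= x.

End Euclidean.

Section Decomposition.
Variables (R : realType) (n N : nat).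

Definition max_neighbours (d : 'I_N -> nat) (A : 'M[R]_n)
    (Rm : forall i, 'M[R]_(d i, n)) : nat :=
  \max_(i < N) #|[set j : 'I_N | Rm j *m A *m (Rm i)^T != 0%R]|.

Definition max_multiplicity (T : finType) (Om : 'I_N -> {set T}) : nat :=
  \max_(K : T) #|[set i : 'I_N | K \in Om i]|.

End Decomposition.

Section CoarseSpaces.
Variables (R : realType) (n N : nat) (d : 'I_N -> nat).
Variables (Rm : forall i, 'M[R]_(d i, n)) (Dm : forall i, 'M[R]_(d i)).

Definition near_kernel_space (G : {vspace 'cV[R]_n}) : {vspace 'cV[R]_n} :=
  (\sum_(i < N) mximage ((Rm i)^T *m Dm i) (mximage (Rm i) G))%VS.

Definition geneo_tau_space (xi : forall i, 'M[R]_(d i))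
    (V : forall j, 'I_(d j) -> 'cV[R]_(d j)) (lam : forall j, 'I_(d j) -> R)
    (tau : R) : {vspace 'cV[R]_n} :=
  (\sum_(j < N) \sum_(k < d j | tau < lam j k)
     <[(Rm j)^T *m Dm j *m (1%:M - xi j) *m V j k]>)%VS.

Definition geneo_gamma_space (p : 'I_N -> nat)
    (U : forall i, 'I_(p i) -> 'cV[R]_(d i)) (mu : forall i, 'I_(p i) -> R)
    (gamma : R) : {vspace 'cV[R]_n} :=
  (\sum_(i < N) \sum_(k < p i | gamma < mu i k)
     <[(Rm i)^T *m Dm i *m U i k]>)%VS.

Definition coarse_projection m (Z : 'M[R]_(n, m)) (Et : 'M[R]_m)
    (A : 'M[R]_n) : 'M[R]_n :=
  Z *m invmx Et *m Z^T *m A.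

Definition soras2 (P0 A : 'M[R]_n) (B xi eta : forall i, 'M[R]_(d i)) :
    'M[R]_n :=
  P0 *m invmx A +
  (1%:M - P0) *m
  (\sum_(i < N) (Rm i)^T *m Dm i *m (1%:M - eta i) *m (1%:M - xi i)
                *m invmx (B i) *m Dm i *m Rm i) *m
  (1%:M - P0^T).

End CoarseSpaces.

(* Main.v *)
(** In the energy product a(.,.) the operator M^-1 A splits as
    a(M^-1 A U, U) = a(P U, U) + sum_i |w_i|^2_{B_i}, where P is the inexact
    coarse projection, w_i is the B_i-orthogonal projection of
    B_i^-1 D_i R_i A W onto W_{i,gamma}, and W = (I - P) U. The eigenvalues of
    E Et^-1 give lm Et <= E <= lp Et as quadratic forms, so P is spectrally
    between lm and lp on V_0, and |(I - P) U|_a <= eps |U|_a there.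

    Upper bound: U is split a-orthogonally as U_0 + U_1 with U_0 in V_0, and the
    sum of the |w_i|^2 is at most k0 gamma a(W, W), where
    a(W, W) <= |U_1|^2 + eps^2 |U_0|^2.

    Lower bound: the two eigenproblems give U = F_0 + Y with F_0 in V_0,
    Y = sum_i R_i^T D_i u_i, u_i in W_{i,gamma} and
    sum_i |u_i|^2_{B_i} <= k1 tau a(U, U). Rewriting U = F + (I - P) Y with F in
    V_0 and applying the Cauchy-Schwarz inequality to each term of
    a(U, U) = a(F, U) + sum_i (B_i u_i, w_i) yields c_T. *)

Require Import Defs.
From HB Require Import structures.
From mathcomp Require Import all_boot all_order all_algebra.
From mathcomp Require Import classical_sets.
From mathcomp Require Import reals.
From mathcomp Require Import ring lra.

Set Implicit Arguments.
Unset Strict Implicit.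
Unset Printing Implicit Defensive.

Import Order.TTheory GRing.Theory Num.Theory.
Local Open Scope ring_scope.

(** * Quadratic forms of matrices: Cauchy-Schwarz, polarisation, coercivity *)

Section Forms.
Variable R : realType.

(** The value at the minimiser t = -b/c gives the bound when c > 0. When c = 0 the affine function
    would be negative somewhere unless b = 0. *)
Lemma discriminant_le (a b c : R) : 0 <= a -> 0 <= c ->
  (forall t, 0 <= a + 2 * b * t + c * t ^+ 2) -> b ^+ 2 <= a * c.
Proof.
move=> a0 c0 h; have [c_eq0|c_neq0] := eqVneq c 0.
  have [->|b0] := eqVneq b 0; first by rewrite expr0n /= mulr_ge0.
  have := h (- (a + 1) / (2 * b)); rewrite c_eq0.
  have -> : a + 2 * b * (- (a + 1) / (2 * b)) + 0 * (- (a + 1) / (2 * b)) ^+ 2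
    = -1 by field.
  lra.
have cgt0 : 0 < c by rewrite lt_neqAle eq_sym c_neq0.
have := h (- b / c).
have -> : a + 2 * b * (- b / c) + c * (- b / c) ^+ 2 = (a * c - b ^+ 2) / c.
  by field.
by rewrite pmulr_lge0 ?invr_gt0 // subr_ge0.
Qed.

Lemma dotE n (u v : 'cV[R]_n) : dot u v = \sum_i u i 0 * v i 0.
Proof. by rewrite /dot mxE; apply: eq_bigr => i _; rewrite mxE. Qed.

Lemma dotC n (u v : 'cV[R]_n) : dot u v = dot v u.
Proof. by rewrite !dotE; apply: eq_bigr => i _; rewrite mulrC. Qed.

Lemma dotDl n (u v w : 'cV[R]_n) : dot (u + v) w = dot u w + dot v w.
Proof. by rewrite /dot linearD mulmxDl mxE. Qed.

Lemma dotZl n a (u w : 'cV[R]_n) : dot (a *: u) w = a * dot u w.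
Proof. by rewrite /dot linearZ /= -scalemxAl mxE. Qed.

Lemma dot0l n (w : 'cV[R]_n) : dot 0 w = 0.
Proof. by rewrite /dot linear0 mul0mx mxE. Qed.

Lemma dot_mull n p (M : 'M[R]_(p, n)) u v : dot (M *m u) v = dot u (M^T *m v).
Proof. by rewrite /dot trmx_mul mulmxA. Qed.

Lemma dot_ge0 n (u : 'cV[R]_n) : 0 <= dot u u.
Proof. by rewrite dotE sumr_ge0 // => i _; rewrite -expr2 sqr_ge0. Qed.

Definition mxform n (M : 'M[R]_n) (u v : 'cV[R]_n) : R := dot (M *m u) v.

Section Bilinear.
Variables (n : nat) (M : 'M[R]_n).
Implicit Types u v w : 'cV[R]_n.

Lemma mxformDl u v w : mxform M (u + v) w = mxform M u w + mxform M v w.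
Proof. by rewrite /mxform mulmxDr dotDl. Qed.
Lemma mxformDr u v w : mxform M w (u + v) = mxform M w u + mxform M w v.
Proof. by rewrite /mxform dotC dotDl !(dotC _ (M *m w)). Qed.
Lemma mxformZl a u w : mxform M (a *: u) w = a * mxform M u w.
Proof. by rewrite /mxform -scalemxAr dotZl. Qed.
Lemma mxformZr a u w : mxform M w (a *: u) = a * mxform M w u.
Proof. by rewrite /mxform dotC dotZl dotC. Qed.
Lemma mxformNl u w : mxform M (- u) w = - mxform M u w.
Proof. by rewrite -scaleN1r mxformZl mulN1r. Qed.
Lemma mxformNr u w : mxform M w (- u) = - mxform M w u.
Proof. by rewrite -scaleN1r mxformZr mulN1r. Qed.
Lemma mxformBl u v w : mxform M (u - v) w = mxform M u w - mxform M v w.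
Proof. by rewrite mxformDl mxformNl. Qed.
Lemma mxformBr u v w : mxform M w (u - v) = mxform M w u - mxform M w v.
Proof. by rewrite mxformDr mxformNr. Qed.
Lemma mxform0l w : mxform M 0 w = 0.
Proof. by rewrite -(scale0r 0) mxformZl mul0r. Qed.
Lemma mxform0r w : mxform M w 0 = 0.
Proof. by rewrite -(scale0r 0) mxformZr mul0r. Qed.
Lemma mxform_suml (I : Type) (r : seq I) (P : pred I) F w :
  mxform M (\sum_(i <- r | P i) F i) w = \sum_(i <- r | P i) mxform M (F i) w.
Proof.
by apply: (big_morph (fun x => mxform M x w)) => [x y|];
  rewrite ?mxformDl ?mxform0l.
Qed.
Lemma mxform_sumr (I : Type) (r : seq I) (P : pred I) F w :
  mxform M w (\sum_(i <- r | P i) F i) = \sum_(i <- r | P i) mxform M w (F i).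
Proof.
by apply: (big_morph (mxform M w)) => [x y|]; rewrite ?mxformDr ?mxform0r.
Qed.
Lemma mxformC u v : M^T = M -> mxform M u v = mxform M v u.
Proof. by move=> Ms; rewrite /mxform dot_mull Ms dotC. Qed.
End Bilinear.

Lemma mxformM n p (M : 'M[R]_n) (X : 'M[R]_(n, p)) (x y : 'cV[R]_p) :
  mxform M (X *m x) (X *m y) = mxform (X^T *m M *m X) x y.
Proof. by rewrite /mxform -!mulmxA dotC dot_mull dotC. Qed.

Definition psd n (M : 'M[R]_n) : Prop :=
  M^T = M /\ forall u, 0 <= mxform M u u.

Lemma spd_psd n (M : 'M[R]_n) : spd M -> psd M.
Proof.
move=> [Ms Mp]; split=> // u; have [->|/Mp/ltW //] := eqVneq u 0.
by rewrite mxform0l.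
Qed.

Lemma spd_unit n (M : 'M[R]_n) : spd M -> M \in unitmx.
Proof.
move=> [Ms Mp]; rewrite -row_free_unit -kermx_eq0; apply/rowV0P => v.
move=> /sub_kermxP vM; apply: trmx_inj; rewrite trmx0; apply/eqP.
apply: contraT => /Mp; rewrite -{1}Ms -trmx_mul vM trmx0 dot0l.
by rewrite ltxx.
Qed.

Lemma mxform_cauchy n (M : 'M[R]_n) u v : psd M ->
  mxform M u v ^+ 2 <= mxform M u u * mxform M v v.
Proof.
move=> [Ms Mp]; apply: discriminant_le => // t.
have := Mp (u + t *: v).
rewrite mxformDl !mxformDr !mxformZl !mxformZr (mxformC v u Ms).
congr (0 <= _); ring.
Qed.

(* Polarisation: 4 K(x, y) = K(x + y, x + y) - K(x - y, x - y). *)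
Lemma mxform_polar_le n (K Q : 'M[R]_n) e x y : K^T = K -> psd Q -> 0 <= e ->
  (forall u, `|mxform K u u| <= e * mxform Q u u) ->
  mxform K x y ^+ 2 <= e ^+ 2 * (mxform Q x x * mxform Q y y).
Proof.
move=> Ks [Qs Qp] e0 h.
have -> : e ^+ 2 * (mxform Q x x * mxform Q y y)
  = (e * mxform Q x x) * (e * mxform Q y y) by ring.
apply: discriminant_le => [||t]; rewrite ?mulr_ge0 //.
have := h (x + t *: y); have := h (x - t *: y).
rewrite !ler_norml => /andP[_ h1] /andP[h2 _].
move: h1 h2; rewrite !mxformDl !mxformDr !mxformNl !mxformNr !mxformZl !mxformZr.
rewrite (mxformC y x Ks) (mxformC y x Qs); lra.
Qed.

(** Each |x_i x_j| is at most (x, x), so the sum of the |K_ij| serves as constant; the added 1 makes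
    it positive, hence invertible. *)
Lemma mxform_bounded n (K : 'M[R]_n) :
  exists2 C : R, 0 < C & forall x, mxform K x x <= C * dot x x.
Proof.
exists (1 + \sum_i \sum_j `|K i j|).
  by rewrite ltr_pwDl // sumr_ge0 // => i _; rewrite sumr_ge0.
move=> x; rewrite mulrDl mul1r; apply: ler_wpDl; first exact: dot_ge0.
have xi i : x i 0 ^+ 2 <= dot x x.
  rewrite dotE (bigD1 i) //= -expr2 lerDl sumr_ge0 // => j _.
  by rewrite -expr2 sqr_ge0.
rewrite /mxform dotE mulr_suml ler_sum // => i _.
rewrite mxE !mulr_suml ler_sum // => j _.
apply: (le_trans (ler_norm _)); rewrite -mulrA normrM ler_wpM2l //.
have := xi i; have := xi j.
have := sqr_ge0 (x j 0 - x i 0); have := sqr_ge0 (x j 0 + x i 0).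
rewrite ler_norml => h1 h2 h3 h4; apply/andP; split; nra.
Qed.

(** No compactness argument: Cauchy-Schwarz for x and P x gives |Px|^4 <= P(x,x) P(Px,Px) <= C
    |Px|^2 P(x,x), hence |Px|^2 <= C P(x,x), while Q(x,x) <= C' |Px|^2 because x = P^-1 P x. *)
Lemma psd_unit_coercive n (P Q : 'M[R]_n) : psd P -> P \in unitmx ->
  exists2 e, 0 < e & forall x, e * mxform Q x x <= mxform P x x.
Proof.
move=> [Ps Pp] Pu.
have [C C0 hC] := mxform_bounded P.
have [C' C'0 hC'] := mxform_bounded ((invmx P)^T *m Q *m invmx P).
exists (C * C')^-1; first by rewrite invr_gt0 mulr_gt0.
move=> x; rewrite mulrC ler_pdivrMr ?mulr_gt0 //.
have -> : mxform Q x x = mxform ((invmx P)^T *m Q *m invmx P) (P *m x) (P *m x).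
  by rewrite -mxformM !mulKmx.
suff h : dot (P *m x) (P *m x) <= C * mxform P x x.
  apply: (le_trans (hC' _)); rewrite [leRHS]mulrC (mulrC C) -mulrA.
  by rewrite ler_wpM2l // ltW.
have := mxform_cauchy x (P *m x) (conj Ps Pp); rewrite {1}/mxform.
have := hC (P *m x); have := dot_ge0 (P *m x); have := Pp x.
set q := dot _ _; set r := mxform P x x; set s := mxform P _ _ => r0 q0 h1 h2.
have [->|q_neq0] := eqVneq q 0; first by rewrite mulr_ge0 // ltW.
have qgt0 : 0 < q by rewrite lt_neqAle eq_sym q_neq0.
rewrite -(ler_pM2r qgt0) -expr2; apply: (le_trans h2).
by rewrite [leRHS]mulrAC mulrC ler_wpM2r.
Qed.

(* The supremum [nu] of the [t] with [S - t Q] semidefinite is attained; there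
   [S - nu Q] is singular, since otherwise it would be coercive and [nu] could
   be increased. So [nu] is an eigenvalue of the pencil. *)
Lemma pencil_lower_bound n (S Q : 'M[R]_n) l : psd S -> spd Q ->
  (forall x (y : 'cV[R]_n), y != 0 -> S *m y = x *: (Q *m y) -> l <= x) ->
  forall x, l * mxform Q x x <= mxform S x x.
Proof.
move=> [Ss Sp] [Qs Qp] hl x0.
have [->|x0n0] := eqVneq x0 0; first by rewrite !mxform0l mulr0.
pose X : set R := [set t : R | forall x, t * mxform Q x x <= mxform S x x]%classic.
have X0 : X 0 by move=> x; rewrite mul0r.
have ubX (x : 'cV[R]_n) : x != 0 -> ubound X (mxform S x x / mxform Q x x).
  by move=> xn0 t /(_ x); rewrite ler_pdivlMr ?Qp.
have supX : has_sup X.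
  split; first by exists 0.
  by exists (mxform S x0 x0 / mxform Q x0 x0); exact: ubX.
pose nu := sup X.
have Xnu : X nu.
  move=> x; have [->|xn0] := eqVneq x 0; first by rewrite !mxform0l mulr0.
  rewrite -ler_pdivlMr; last exact: Qp.
  by apply: ge_sup; [exists 0|exact: ubX].
have fP x y : mxform (S - nu *: Q) x y = mxform S x y - nu * mxform Q x y.
  by rewrite /mxform mulmxBl -scalemxAl -scaleN1r dotDl !dotZl mulN1r.
have Ppsd : psd (S - nu *: Q).
  by split; [rewrite linearB linearZ /= Ss Qs|move=> u; rewrite fP subr_ge0].
suff : l <= nu.
  move=> lnu; apply: le_trans (Xnu x0); rewrite ler_wpM2r //; exact/ltW/Qp.
have : S - nu *: Q \notin unitmx.
  apply/negP => /(psd_unit_coercive Q Ppsd)[e e0 he].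
  have : X (nu + e) by move=> x; have := he x; rewrite fP; lra.
  move=> /(ub_le_sup (proj2 supX)); rewrite -/nu; lra.
rewrite -row_free_unit -kermx_eq0 => /rowV0Pn[v /sub_kermxP vP vn0].
apply: (hl nu v^T); first by rewrite -trmx0 (inj_eq trmx_inj).
apply/eqP; rewrite -subr_eq0 scalemxAl -mulmxBl.
by rewrite -(proj1 Ppsd) -trmx_mul vP trmx0.
Qed.

(** Transposition turns v E = x v Q into E v^T = x Q v^T, both matrices being symmetric. This is the
    pencil form that [pencil_lower_bound] expects. *)
Lemma eigenvalue_mulmx_invP n (E Q : 'M[R]_n) x : E^T = E -> spd Q ->
  reflect (exists2 y : 'cV[R]_n, y != 0 & E *m y = x *: (Q *m y))
          (eigenvalue (E *m invmx Q) x).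
Proof.
move=> Es Qspd; have Qu := spd_unit Qspd; have [Qs _] := Qspd.
apply: (iffP eigenvalueP) => [[v vE vn0]|[y yn0 h]].
  exists v^T; first by rewrite -trmx0 (inj_eq trmx_inj).
  apply: trmx_inj; rewrite linearZ /= !trmx_mul !trmxK Es Qs scalemxAl -vE.
  by rewrite !mulmxA mulmxKV.
exists y^T; last by rewrite -trmx0 (inj_eq trmx_inj).
rewrite mulmxA -{1}Es -trmx_mul h linearZ /= trmx_mul Qs -scalemxAl.
by rewrite mulmxK.
Qed.

(** * Spectral comparison of the exact and inexact coarse matrices *)

Section Pencil.
Variables (m : nat) (E Et : 'M[R]_m) (lp lm : R).
Hypotheses (E_spd : spd E) (Et_spd : spd Et).
Hypothesis (lp_max : largest_eigenvalue (E *m invmx Et) lp).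
Hypothesis (lm_min : smallest_eigenvalue (E *m invmx Et) lm).

Lemma pencil_eigenvalue_gt0 x : eigenvalue (E *m invmx Et) x -> 0 < x.
Proof.
move/(eigenvalue_mulmx_invP _ (proj1 E_spd) Et_spd) => [y yn0 h].
have := proj2 E_spd y yn0; rewrite h dotZl pmulr_lgt0 //.
exact: (proj2 Et_spd).
Qed.

Lemma smallest_eigenvalue_gt0 : 0 < lm.
Proof. exact: pencil_eigenvalue_gt0 (proj1 lm_min). Qed.

Lemma largest_eigenvalue_gt0 : 0 < lp.
Proof. exact: pencil_eigenvalue_gt0 (proj1 lp_max). Qed.

Lemma smallest_eigenvalue_form x : lm * mxform Et x x <= mxform E x x.
Proof.
apply: pencil_lower_bound => //; first exact: spd_psd.
move=> z y yn0 h; apply: (proj2 lm_min).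
by apply/(eigenvalue_mulmx_invP _ (proj1 E_spd) Et_spd); exists y.
Qed.

(** Obtained from the swapped pencil Et y = z E y: its eigenvalues are the inverses of those of E
    Et^-1, so 1/lp bounds them from below. *)
Lemma largest_eigenvalue_form x : mxform E x x <= lp * mxform Et x x.
Proof.
rewrite mulrC -ler_pdivrMr ?largest_eigenvalue_gt0 // mulrC.
apply: pencil_lower_bound => //; first exact: spd_psd.
move=> z y yn0 h.
have z0 : 0 < z.
  have := proj2 Et_spd y yn0; rewrite h dotZl pmulr_lgt0 //.
  exact: (proj2 E_spd).
rewrite -(invrK z) lef_pV2 ?posrE ?invr_gt0 ?largest_eigenvalue_gt0 //.
apply: (proj2 lp_max).
apply/(eigenvalue_mulmx_invP _ (proj1 E_spd) Et_spd); exists y => //.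
by rewrite h scalerA mulVf ?scale1r // gt_eqF.
Qed.

(** Cauchy-Schwarz in Et for f and Et^-1 g, then lm Et <= E. With g = Z^T A U it controls the coarse
    term a(Z f, U) by a(P U, U). *)
Lemma form_solve_cauchy f g :
  lm * dot f g ^+ 2 <= mxform E f f * dot g (invmx Et *m g).
Proof.
have Eu := spd_unit Et_spd; have Ep := spd_psd Et_spd.
have qE : mxform Et (invmx Et *m g) (invmx Et *m g) = dot g (invmx Et *m g).
  by rewrite /mxform mulKVmx.
have h := mxform_cauchy f (invmx Et *m g) Ep; rewrite qE in h.
have -> : dot f g = mxform Et f (invmx Et *m g).
  by rewrite mxformC ?(proj1 Ep) // /mxform mulKVmx // dotC.
apply: (le_trans (ler_wpM2l (ltW smallest_eigenvalue_gt0) h)).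
rewrite mulrA ler_wpM2r ?smallest_eigenvalue_form //.
by rewrite -qE; apply: (proj2 Ep).
Qed.

(** With h = Et^-1 E c and q = E(c,h) = Et(h,h), Cauchy-Schwarz in E gives q^2 <= E(c,c) E(h,h) <=
    lp E(c,c) q; one factor q cancels. *)
Lemma solve_form_upper c :
  dot (E *m c) (invmx Et *m (E *m c)) <= lp * mxform E c c.
Proof.
have Eu := spd_unit Et_spd; have Ep := spd_psd Et_spd.
set h := invmx Et *m _.
have qE : mxform Et h h = dot (E *m c) h by rewrite /mxform mulKVmx.
have q0 : 0 <= dot (E *m c) h by rewrite -qE; exact: (proj2 Ep).
have := mxform_cauchy c h (spd_psd E_spd); rewrite {1}/mxform.
have := largest_eigenvalue_form h; rewrite qE.
have := proj2 (spd_psd E_spd) c; have := largest_eigenvalue_gt0.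
move: (dot (E *m c) h) q0 => q q0.
move: (mxform E h h) (mxform E c c) => r s lp0 s0 h1 h2.
have [->|qn0] := eqVneq q 0; first by rewrite mulr_ge0 // ltW.
have qgt0 : 0 < q by rewrite lt_neqAle eq_sym qn0.
rewrite -(ler_pM2r qgt0) -expr2; apply: (le_trans h2).
by rewrite (mulrC lp) -mulrA ler_wpM2l.
Qed.

Lemma solve_form_lower c :
  lm * mxform E c c <= dot (E *m c) (invmx Et *m (E *m c)).
Proof.
have := form_solve_cauchy c (E *m c).
rewrite (dotC c) -/(mxform E c c).
have := proj2 (spd_psd E_spd) c.
have [->|cn0] := eqVneq c 0.
  by rewrite mxform0l mulr0 mulmx0 dot0l.
move=> c0; rewrite expr2 mulrA [leRHS]mulrC ler_pM2r //.
exact: (proj2 E_spd).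
Qed.

Let eps := Num.max `|1 - lm| `|1 - lp|.

(** For K = E - E Et^-1 E one has K(x,y) = E(x, (I - Et^-1 E) y), and |K(u,u)| <= eps E(u,u) since E
    Et^-1 E lies between lm E and lp E. The polarised bound at x = d, y = c, with [d] the error
    vector, reads E(d,d)^2 <= eps^2 E(d,d) E(c,c). *)
Lemma coarse_error_bound c :
  mxform E (c - invmx Et *m (E *m c)) (c - invmx Et *m (E *m c))
  <= eps ^+ 2 * mxform E c c.
Proof.
set d := c - _; have eps0 : 0 <= eps by rewrite le_max normr_ge0.
have Es := proj1 E_spd; have Ep := spd_psd E_spd.
pose K := E - E *m invmx Et *m E.
have KE x y : mxform K x y = mxform E x (y - invmx Et *m (E *m y)).
  rewrite /mxform (dot_mull E) (dot_mull K); congr (dot _ _).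
  rewrite /K linearB /= !trmx_mul Es trmx_inv (proj1 Et_spd).
  by rewrite mulmxBr mulmxBl !mulmxA.
have Ks : K^T = K.
  by rewrite /K linearB /= !trmx_mul Es trmx_inv (proj1 Et_spd) mulmxA.
have hK u : `|mxform K u u| <= eps * mxform E u u.
  have := solve_form_upper u; have := solve_form_lower u.
  rewrite KE mxformBr -/(mxform E u (invmx Et *m (E *m u))).
  rewrite -{1 3}/(mxform E u (invmx Et *m (E *m u))).
  have := proj2 Ep u.
  have h1 : `|1 - lm| <= eps by rewrite le_max lexx.
  have h2 : `|1 - lp| <= eps by rewrite le_max lexx orbT.
  move: h1 h2; rewrite !ler_norml => /andP[h1 h2] /andP[h3 h4] h5 h6 h7.
  by apply/andP; split; nra.
have := mxform_polar_le d c Ks Ep eps0 hK.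
rewrite KE -/d.
have := proj2 Ep d; have := proj2 Ep c.
move: (mxform E d d) (mxform E c c) => q r r0 q0 h.
have [->|qn0] := eqVneq q 0; first by rewrite mulr_ge0 // sqr_ge0.
have qgt0 : 0 < q by rewrite lt_neqAle eq_sym qn0.
by rewrite -(ler_pM2r qgt0) -expr2 -mulrA (mulrC r).
Qed.
End Pencil.
End Forms.

(** * Eigenvector families cut at a threshold, and sums over subdomains *)

Section SpectralFamilies.
Variable R : realType.

Lemma memv_sum_lineP n p (V : 'I_p -> 'cV[R]_n) (P : pred 'I_p) y :
  y \in (\sum_(k < p | P k) <[V k]>)%VS ->
  exists c : 'I_p -> R, y = \sum_(k < p | P k) c k *: V k.
Proof.
move=> /memv_sumP[vs vsV ->].
have /fin_all_exists[c hc] k : exists a, P k -> vs k = a *: V k.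
  by case Pk: (P k); [have /vlineP[a ->] := vsV k Pk; exists a|exists 0].
by exists c; apply: eq_bigr => k Pk; exact: hc.
Qed.

Section Family.
Variables (n p : nat) (C Q : 'M[R]_n) (V : 'I_p -> 'cV[R]_n) (lam : 'I_p -> R).
Hypotheses (Cs : C^T = C) (Qpsd : psd Q).
Hypothesis V_eigen : forall k l,
  mxform C (V k) (V l) = lam k * mxform Q (V k) (V l).
Variable t : R.

Let low := (\sum_(k < p | (lam k <= t)%R) <[V k]>)%VS.
Let high := (\sum_(k < p | (t < lam k)%R) <[V k]>)%VS.

Lemma eigen_family_orth k l : lam k != lam l -> mxform Q (V k) (V l) = 0.
Proof.
move=> kl; have := V_eigen k l; rewrite (mxformC _ _ Cs) V_eigen.
rewrite (mxformC _ _ (proj1 Qpsd)) => /eqP; rewrite -subr_eq0 -mulrBl mulf_eq0.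
by rewrite subr_eq0 eq_sym (negbTE kl) /= => /eqP.
Qed.

Lemma low_high_orth y h : y \in low -> h \in high -> mxform Q y h = 0.
Proof.
move=> /memv_sum_lineP[c ->] /memv_sum_lineP[e ->].
rewrite mxform_suml big1 // => k lk; rewrite mxform_sumr big1 // => l ll.
rewrite mxformZl mxformZr eigen_family_orth ?mulr0 //.
by rewrite lt_eqF // (le_lt_trans lk ll).
Qed.

(* Eigenvectors of a common eigenvalue need not be orthogonal. Since
   (t - lam k) Q(V k, V l) = s_k s_l Q(V k, V l) for s_k = sqrt (t - lam k),
   the difference of the two sides is Q(x, x) with x = sum_k c_k s_k V_k. *)
Lemma low_form_le y : y \in low -> mxform C y y <= t * mxform Q y y.
Proof.
move=> /memv_sum_lineP[c ->].
pose s k := Num.sqrt (t - lam k).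
rewrite -subr_ge0.
suff -> : t * mxform Q (\sum_(k | lam k <= t) c k *: V k)
                     (\sum_(k | lam k <= t) c k *: V k)
          - mxform C (\sum_(k | lam k <= t) c k *: V k)
                   (\sum_(k | lam k <= t) c k *: V k)
  = mxform Q (\sum_(k | lam k <= t) (c k * s k) *: V k)
           (\sum_(k | lam k <= t) (c k * s k) *: V k).
  exact: (proj2 Qpsd).
rewrite !mxform_suml mulr_sumr -sumrB; apply: eq_bigr => k lk.
rewrite !mxform_sumr mulr_sumr -sumrB; apply: eq_bigr => l ll.
rewrite !mxformZl !mxformZr V_eigen.
have [kl|kl] := eqVneq (lam k) (lam l); last first.
  by rewrite eigen_family_orth // !mulr0 subrr.
have ss : s k * s l = t - lam k.
  by rewrite /s -kl -expr2 sqr_sqrtr // subr_ge0.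
rewrite -[RHS]mulrA; have -> : c k * (s k * (c l * s l * mxform Q (V k) (V l)))
  = c k * c l * (s k * s l) * mxform Q (V k) (V l) by ring.
rewrite ss; ring.
Qed.

(** Pythagoras, since [low] and [high] are Q-orthogonal. *)
Lemma low_form_decr y h : y \in low -> h \in high ->
  mxform Q y y <= mxform Q (y + h) (y + h).
Proof.
move=> yl hh; rewrite mxformDl !mxformDr (mxformC h y (proj1 Qpsd)).
by rewrite (low_high_orth yl hh) addr0 add0r lerDl (proj2 Qpsd).
Qed.

Lemma basis_split_low_high (W : {vspace 'cV[R]_n}) x :
  basis_of W [tuple V k | k < p] -> x \in W ->
  exists y h, [/\ y \in low, h \in high & x = y + h].
Proof.
move=> /andP[/eqP WE _]; rewrite -WE span_def big_map big_enum /=.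
rewrite (bigID (fun k => lam k <= t)) /= => /memv_addP[y yl [h hh ->]].
exists y, h; split=> //; rewrite /high.
by under eq_bigl => k do rewrite ltNge.
Qed.
End Family.

Lemma basis_of_cols n m (Z : 'M[R]_(n, m)) (W : {vspace 'cV[R]_n}) :
  basis_of W [tuple col k Z | k < m] ->
  (forall x, x \in W -> exists f, x = Z *m f) /\
  (forall f : 'cV[R]_m, Z *m f = 0 -> f = 0).
Proof.
have ZE (f : 'cV[R]_m) : Z *m f = \sum_k f k 0 *: col k Z.
  apply/matrixP => i j; rewrite ord1 mxE summxE; apply: eq_bigr => k _.
  by rewrite !mxE mulrC.
move=> bZ; split=> [x xW|f].
  exists (\col_k coord [tuple col k Z | k < m] k x); rewrite ZE.
  rewrite {1}(coord_basis bZ xW); apply: eq_bigr => k _.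
  by rewrite mxE -tnth_nth tnth_mktuple.
rewrite ZE => f0; have /freeP h := basis_free bZ.
apply/matrixP => i j; rewrite ord1 mxE.
apply: (h (fun i => f i 0)); rewrite -{}[RHS]f0; apply: eq_bigr => k _.
by rewrite -tnth_nth tnth_mktuple.
Qed.

(** Only neighbouring pairs contribute, each through 2 a(x,y) <= a(x,x) + a(y,y). Symmetry of [nb]
    makes the two halves of the double sum equal, each counting a(X_i, X_i) once per neighbour of
    i. *)
Lemma form_sum_neighbours n N (A : 'M[R]_n) (X : 'I_N -> 'cV[R]_n)
    (nb : rel 'I_N) k :
  psd A -> symmetric nb ->
  (forall i j, ~~ nb i j -> mxform A (X i) (X j) = 0) ->
  (forall i, #|[set j | nb i j]| <= k)%N ->
  mxform A (\sum_i X i) (\sum_i X i) <= k%:R * \sum_i mxform A (X i) (X i).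
Proof.
move=> [As Ap] nb_sym nb0 nbk; pose q i := mxform A (X i) (X i).
have card_sum (a : R) i : \sum_(j | nb i j) a = a *+ #|[set j | nb i j]|.
  by rewrite -sumr_const; apply: eq_bigl => j; rewrite inE.
apply: (@le_trans _ _ (\sum_i \sum_(j | nb i j) (q i + q j) / 2)).
  rewrite mxform_suml ler_sum // => i _; rewrite mxform_sumr (bigID (nb i)) /=.
  rewrite [X in _ + X]big1 ?addr0; last by move=> j /nb0.
  rewrite ler_sum // => j _; have := Ap (X i - X j).
  rewrite mxformBl !mxformBr (mxformC (X j) _ As) /q; lra.
have -> : \sum_i \sum_(j | nb i j) (q i + q j) / 2
  = \sum_i q i *+ #|[set j | nb i j]|.
  under eq_bigr => i _ do rewrite -mulr_suml big_split /= mulrDl.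
  rewrite big_split /= -!mulr_suml [X in _ + X / 2](exchange_big_dep predT) //=.
  under [X in _ + X / 2]eq_bigr => j _ do
    (under eq_bigl => i do rewrite nb_sym); rewrite -mulrDr -mulr2n.
  have -> : \sum_i \sum_(j | nb i j) q i = \sum_i q i *+ #|[set j | nb i j]|.
    by apply: eq_bigr => i _; rewrite card_sum.
  by field.
rewrite mulr_sumr ler_sum // => i _.
by rewrite -[leLHS]mulr_natl ler_wpM2r ?ler_nat ?Ap.
Qed.

(** The local quadratics B_i(u_i + t w_i, u_i + t w_i) add up to a nonnegative polynomial in t, to
    which the discriminant bound applies. *)
Lemma sum_form_cauchy N (d : 'I_N -> nat) (B : forall i, 'M[R]_(d i))
    (u w : forall i, 'cV[R]_(d i)) : (forall i, psd (B i)) ->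
  (\sum_i mxform (B i) (u i) (w i)) ^+ 2
  <= (\sum_i mxform (B i) (u i) (u i)) * \sum_i mxform (B i) (w i) (w i).
Proof.
move=> Bp; apply: discriminant_le => [||t].
- by apply: sumr_ge0 => i _; exact: (proj2 (Bp i)).
- by apply: sumr_ge0 => i _; exact: (proj2 (Bp i)).
rewrite mulr_sumr !mulr_suml -!big_split /=; apply: sumr_ge0 => i _.
have := proj2 (Bp i) (u i + t *: w i).
rewrite mxformDl !mxformDr !mxformZl !mxformZr (mxformC (w i) _ (proj1 (Bp i))).
by congr (0 <= _); ring.
Qed.
End SpectralFamilies.

(** * Scalar inequalities that combine two Cauchy-Schwarz estimates *)

Section TwoTerms.
Variable R : realType.

Lemma le_of_sqr_le (x y : R) : 0 <= y -> x ^+ 2 <= y ^+ 2 -> x <= y.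
Proof.
by move=> y0 h; apply: (le_trans (ler_norm x)); rewrite -(ger0_norm y0) -ler_sqr
  ?nnegrE // !real_normK ?num_real.
Qed.

(** The cross term obeys (2xy)^2 <= 4 p1 q1 p2 q2 <= (p1 q2 + p2 q1)^2. *)
Lemma sqr_sum_le (x y p1 q1 p2 q2 : R) :
  0 <= p1 -> 0 <= q1 -> 0 <= p2 -> 0 <= q2 ->
  x ^+ 2 <= p1 * q1 -> y ^+ 2 <= p2 * q2 ->
  (x + y) ^+ 2 <= (p1 + p2) * (q1 + q2).
Proof.
move=> p10 q10 p20 q20 hx hy.
have : 2 * x * y <= p1 * q2 + p2 * q1.
  apply: le_of_sqr_le; first by rewrite addr_ge0 ?mulr_ge0.
  have h : x ^+ 2 * y ^+ 2 <= (p1 * q1) * (p2 * q2).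
    by rewrite ler_pM ?sqr_ge0.
  have := sqr_ge0 (p1 * q2 - p2 * q1); move: h; rewrite !expr2; lra.
rewrite !expr2 in hx hy *; lra.
Qed.
End TwoTerms.

(** * Abstract two-level estimate; [X i], [kappa], [theta] stand for R_i^T D_i, k0 gamma, k1 tau *)

Section TwoLevel.
Variables (R : realType) (n N m : nat) (A : 'M[R]_n) (Z : 'M[R]_(n, m)).
Variables (Et : 'M[R]_m) (lp lm : R).
Variables (d : 'I_N -> nat) (X : forall i, 'M[R]_(n, d i)).
Variables (B Pi : forall i, 'M[R]_(d i)).
Variables (L : forall i, {vspace 'cV[R]_(d i)}) (kappa theta : R).
Hypotheses (A_spd : spd A) (Z_inj : forall f : 'cV[R]_m, Z *m f = 0 -> f = 0).
Hypothesis Et_spd : spd Et.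
Let E := Z^T *m A *m Z.
Hypothesis lp_max : largest_eigenvalue (E *m invmx Et) lp.
Hypothesis lm_min : smallest_eigenvalue (E *m invmx Et) lm.
Hypothesis B_psd : forall i, psd (B i).
(* [Pi i] composes [invmx (B i)] with the B_i-orthogonal projection onto [L i]. *)
Hypothesis Pi_in : forall i g, Pi i *m g \in L i.
Hypothesis Pi_dual :
  forall i u g, u \in L i -> mxform (B i) u (Pi i *m g) = dot u g.
Hypothesis kappa_ge0 : 0 <= kappa.
Hypothesis theta_ge0 : 0 <= theta.
Hypothesis continuity : forall u : forall i, 'cV[R]_(d i),
  (forall i, u i \in L i) ->
  mxform A (\sum_i X i *m u i) (\sum_i X i *m u i)
  <= kappa * \sum_i mxform (B i) (u i) (u i).
Hypothesis stability : forall U : 'cV[R]_n, exists u : forall i, 'cV[R]_(d i),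
  [/\ forall i, u i \in L i,
      exists f, U = Z *m f + \sum_i X i *m u i
    & \sum_i mxform (B i) (u i) (u i) <= theta * mxform A U U].

Let eps := Num.max `|1 - lm| `|1 - lp|.
Let P := coarse_projection Z Et A.
Let S := \sum_i X i *m Pi i *m (X i)^T.
Let M := P *m invmx A + (1%:M - P) *m S *m (1%:M - P^T).
Let As : A^T = A := proj1 A_spd.
Let Apsd : psd A := spd_psd A_spd.

Implicit Types (U x y : 'cV[R]_n) (f g c : 'cV[R]_m).

Lemma coarse_spd : spd E.
Proof.
split; first by rewrite /E !trmx_mul trmxK As mulmxA.
move=> c cn0; rewrite -/(mxform E c c) -mxformM; apply: (proj2 A_spd).
by apply: contraNneq cn0 => /Z_inj ->.
Qed.

Lemma coarse_projection_mul U : P *m U = Z *m (invmx Et *m (Z^T *m A *m U)).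
Proof. by rewrite /P /coarse_projection !mulmxA. Qed.

Lemma mxform_range f U : mxform A (Z *m f) U = dot f (Z^T *m A *m U).
Proof. by rewrite /mxform !dot_mull As -mulmxA. Qed.

Lemma mxform_range2 f g : mxform A (Z *m f) (Z *m g) = mxform E f g.
Proof. exact: mxformM. Qed.

(** [P] is self-adjoint for a(.,.), although it is not idempotent when Et differs from E. *)
Lemma coarse_projection_tr : P^T *m A = A *m P.
Proof.
rewrite /P /coarse_projection !trmx_mul trmxK As trmx_inv (proj1 Et_spd).
by rewrite !mulmxA.
Qed.

Lemma mxform_complement x y :
  mxform A ((1%:M - P) *m x) y = mxform A x (y - P *m y).
Proof.
rewrite mulmxBl mul1mx mxformBl mxformBr; congr (_ - _).
by rewrite /mxform mulmxA -coarse_projection_tr -mulmxA dot_mull trmxK.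
Qed.

Let resid U := U - P *m U.
Let w U i := Pi i *m ((X i)^T *m (A *m resid U)).
Let Phi U := \sum_i mxform (B i) (w U i) (w U i).

(** Through B_i, [w U i] represents on [L i] the functional u |-> a(X_i u, (I - P) U). *)
Lemma local_duality U (u : forall i, 'cV[R]_(d i)) : (forall i, u i \in L i) ->
  mxform A (\sum_i X i *m u i) (resid U) = \sum_i mxform (B i) (u i) (w U i).
Proof.
move=> uL; rewrite mxform_suml; apply: eq_bigr => i _.
by rewrite (Pi_dual _ (uL i)) /mxform !dot_mull As.
Qed.

(** Self-adjointness of [P] moves the left factor I - P to the second argument and turns (I - P^T) A
    U into A (I - P) U; duality with u_i = [w U i] then produces [Phi U]. *)
Lemma soras_form U :
  mxform A (M *m A *m U) U = mxform A (P *m U) U + Phi U.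
Proof.
have Au := spd_unit A_spd.
rewrite /M 2!mulmxDl mulmxKV // mxformDl; congr (_ + _).
rewrite -!mulmxA mxform_complement.
have -> : (1%:M - P^T) *m (A *m U) = A *m resid U.
  by rewrite mulmxBl mul1mx mulmxA coarse_projection_tr mulmxBr -mulmxA.
rewrite -/(resid U) /Phi -(local_duality U (fun i => Pi_in _)) /S mulmx_suml.
by congr (mxform A _ _); apply: eq_bigr => i _; rewrite -!mulmxA.
Qed.

Lemma Phi_ge0 U : 0 <= Phi U.
Proof. by apply: sumr_ge0 => i _; exact: (proj2 (B_psd i)). Qed.

(** [Z *m coef U] is the a-orthogonal projection of [U] onto the coarse space, the result of an
    exact coarse solve. *)
Let coef U := invmx E *m (Z^T *m A *m U).

Lemma mul_coef U : E *m coef U = Z^T *m A *m U.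
Proof. by rewrite /coef mulKVmx // spd_unit //; exact: coarse_spd. Qed.

Lemma mxform_coef f U : mxform A (Z *m f) U = mxform E f (coef U).
Proof.
by rewrite mxform_range -mul_coef dotC (mxformC _ _ (proj1 coarse_spd)).
Qed.

Lemma coarse_projection_coef U :
  P *m U = Z *m (invmx Et *m (E *m coef U)).
Proof. by rewrite coarse_projection_mul mul_coef. Qed.

Lemma mxform_projection U : mxform A (P *m U) U
  = dot (E *m coef U) (invmx Et *m (E *m coef U)).
Proof. by rewrite coarse_projection_coef mxform_range -mul_coef dotC. Qed.

(** Defect of the inexact solve in coarse coordinates: [Z *m err c] equals (I - P) Z c. *)
Let err c := c - invmx Et *m (E *m c).

Lemma mxform_pythagoras U f : mxform A (U - Z *m coef U + Z *m f)
    (U - Z *m coef U + Z *m f)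
  = mxform A (U - Z *m coef U) (U - Z *m coef U) + mxform E f f.
Proof.
set U1 := U - _.
have orth : mxform A (Z *m f) U1 = 0.
  by rewrite mxformBr mxform_coef mxform_range2 subrr.
move: U1 orth => U1 orth.
rewrite mxformDl !mxformDr (mxformC U1 (Z *m f) As) orth addr0 add0r.
by rewrite mxform_range2.
Qed.

Lemma mxform_split U : mxform A U U
  = mxform A (U - Z *m coef U) (U - Z *m coef U) + mxform E (coef U) (coef U).
Proof. by rewrite -mxform_pythagoras subrK. Qed.

Lemma mxform_coef_le U : mxform E (coef U) (coef U) <= mxform A U U.
Proof. by rewrite [leRHS]mxform_split lerDr (proj2 Apsd). Qed.

(** By duality Phi = a(sum_i X_i w_i, W) with W = (I - P) U, so Cauchy-Schwarz and [continuity] give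
    Phi^2 <= kappa Phi a(W,W); one factor Phi cancels. *)
Lemma Phi_le U : Phi U <= kappa * mxform A (resid U) (resid U).
Proof.
have wL i : w U i \in L i by exact: Pi_in.
have h := mxform_cauchy (\sum_i X i *m w U i) (resid U) Apsd.
have k := continuity wL.
rewrite (local_duality U wL) -/(Phi U) in h k *.
have [->|Pn0] := eqVneq (Phi U) 0.
  by rewrite mulr_ge0 // (proj2 Apsd).
have Pgt0 : 0 < Phi U by rewrite lt_neqAle eq_sym Pn0 Phi_ge0.
rewrite -(ler_pM2r Pgt0) -expr2; apply: (le_trans h).
by rewrite [leRHS]mulrAC ler_wpM2r // (proj2 Apsd).
Qed.

(** I - P fixes the component a-orthogonal to the coarse space and acts only on the coarse one. *)
Lemma resid_split U :
  resid U = U - Z *m coef U + Z *m err (coef U).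
Proof.
by rewrite /resid /err mulmxBr coarse_projection_coef addrA subrK.
Qed.

Let cR := (kappa * (1 + eps ^+ 2) + lp
  + Num.sqrt ((kappa * (1 + eps ^+ 2) - lp) ^+ 2 + 4 * lp * kappa * eps ^+ 2)) / 2.

(* c_R is the larger root of t^2 - (kappa (1 + eps^2) + lp) t + lp kappa, a
   polynomial that takes the value - (kappa eps)^2 at both t below. *)
Lemma le_upper_constant : kappa <= cR /\ kappa * eps ^+ 2 + lp <= cR.
Proof.
have lp0 := largest_eigenvalue_gt0 coarse_spd Et_spd lp_max.
have root t : t ^+ 2 - (kappa * (1 + eps ^+ 2) + lp) * t + lp * kappa <= 0 ->
    t <= cR.
  move=> ht; rewrite /cR ler_pdivlMr // -lerBlDl.
  apply: le_of_sqr_le; first exact: sqrtr_ge0.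
  rewrite sqr_sqrtr.
    move: ht; rewrite !expr2; lra.
  apply: addr_ge0; first exact: sqr_ge0.
  by apply: mulr_ge0 (sqr_ge0 _); rewrite !mulr_ge0 // ltW.
have h := sqr_ge0 (kappa * eps).
by split; apply: root; move: h; rewrite !expr2; lra.
Qed.

(** The form is at most kappa |U_1|^2 + (kappa eps^2 + lp) |U_0|^2, and [le_upper_constant] bounds
    both coefficients. *)
Lemma soras_upper U : mxform A (M *m A *m U) U <= cR * mxform A U U.
Proof.
rewrite soras_form mxform_split mxform_projection.
have := Phi_le U; rewrite resid_split mxform_pythagoras.
have := coarse_error_bound coarse_spd Et_spd lp_max lm_min (coef U).
rewrite -/eps -/(err _).
have := solve_form_upper coarse_spd Et_spd lp_max (coef U).
have [] := le_upper_constant.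
have := proj2 Apsd (U - Z *m coef U).
have := proj2 (spd_psd coarse_spd) (coef U).
move: (Phi U) (dot _ _) (mxform E (err _) _) (mxform E _ _) (mxform A _ _).
move=> ph q e s a s0 a0 h1 h2 h3 h4 h5; rewrite mulrDr addrC.
have h6 := ler_wpM2l kappa_ge0 h4.
have h7 := ler_wpM2r a0 h1; have h8 := ler_wpM2r s0 h2.
lra.
Qed.

Let r := eps * Num.sqrt (kappa * theta).
Let cT := lm / ((1 + r) ^+ 2 + lm * theta).

Lemma soras_lower U : cT * mxform A U U <= mxform A (M *m A *m U) U.
Proof.
have Epsd := spd_psd coarse_spd.
have lm0 := smallest_eigenvalue_gt0 coarse_spd Et_spd lm_min.
have eps0 : 0 <= eps by rewrite le_max normr_ge0.
have r0 : 0 <= r by rewrite mulr_ge0 // sqrtr_ge0.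
have [u [uL [f0 Uf] hu]] := stability U.
set Y := \sum_i X i *m u i in Uf.
set alpha := mxform A U U in hu *.
have a0 : 0 <= alpha by exact: (proj2 Apsd).
have YY : mxform A Y Y <= kappa * theta * alpha.
  by apply: (le_trans (continuity uL)); rewrite -mulrA ler_wpM2l.
(* Moving P Y into the coarse part gives F = F_0 + P Y, with coordinates f0 + coef Y - err (coef Y),
   where f0 + coef Y = coef U. *)
pose f := coef U - err (coef Y).
have cU : coef U = f0 + coef Y.
  rewrite /coef {1}Uf mulmxDr (mulmxA _ Z) -/E mulmxDr mulKmx //.
  exact: spd_unit coarse_spd.
have UE : U = Z *m f + (1%:M - P) *m Y.
  rewrite {1}Uf /f cU /err mulmxBl mul1mx coarse_projection_coef.
  move: (coef Y) (invmx Et *m _) => y s.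
  by rewrite opprB addrACA subrr addr0 mulmxDr -addrA (addrC (Z *m s)) subrK.
have aE : alpha = dot f (Z^T *m A *m U) + \sum_i mxform (B i) (u i) (w U i).
  by rewrite /alpha {1}UE mxformDl mxform_range mxform_complement local_duality.
have h1 := form_solve_cauchy coarse_spd Et_spd lm_min f (Z^T *m A *m U).
rewrite -mul_coef -mxform_projection mul_coef in h1.
have h2 := sum_form_cauchy u (w U) B_psd; rewrite -/(Phi U) in h2.
have q0 : 0 <= mxform A (P *m U) U.
  have := solve_form_lower coarse_spd Et_spd lm_min (coef U).
  rewrite mxform_projection; apply: le_trans.
  by rewrite mulr_ge0 ?(ltW lm0) // (proj2 Epsd).
(* The factor 1 + r comes from the triangle inequality in the E-norm: |coef U| <= |U|_a and |err
   (coef Y)| <= r |U|_a. *)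
have f_le : mxform E f f <= (1 + r) ^+ 2 * alpha.
  have ey : mxform E (err (coef Y)) (err (coef Y)) <= r ^+ 2 * alpha.
    have := coarse_error_bound coarse_spd Et_spd lp_max lm_min (coef Y).
    rewrite -/eps -/(err _) => /le_trans; apply.
    rewrite /r exprMn sqr_sqrtr ?mulr_ge0 // -[leRHS]mulrA.
    by rewrite ler_wpM2l ?sqr_ge0 // (le_trans (mxform_coef_le _)).
  have cs := mxform_cauchy (coef U) (err (coef Y)) Epsd.
  have cl := mxform_coef_le U; rewrite -/alpha in cl.
  rewrite /f; move: (err _) (coef U) ey cs cl => e c ey cs cl.
  rewrite mxformBl !mxformBr (mxformC e c (proj1 Epsd)).
  have : - mxform E c e <= r * alpha.
    apply: le_of_sqr_le; first by rewrite mulr_ge0.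
    rewrite sqrrN; apply: (le_trans cs).
    have -> : (r * alpha) ^+ 2 = alpha * (r ^+ 2 * alpha) by ring.
    by rewrite ler_pM ?(proj2 Epsd).
  rewrite !expr2 in ey *; lra.
have x2 : dot f (Z^T *m A *m U) ^+ 2
    <= ((1 + r) ^+ 2 / lm) * (alpha * mxform A (P *m U) U).
  rewrite mulrAC ler_pdivlMr // mulrC; apply: (le_trans h1).
  by rewrite mulrA ler_wpM2r.
have y2 : (\sum_i mxform (B i) (u i) (w U i)) ^+ 2
    <= theta * (alpha * Phi U).
  by apply: (le_trans h2); rewrite mulrA ler_wpM2r ?Phi_ge0.
have d0 : 0 < (1 + r) ^+ 2 + lm * theta.
  by rewrite ltr_wpDr ?mulr_ge0 ?(ltW lm0) // exprn_gt0 // ltr_wpDr.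
(* Both estimates share the factor alpha, so alpha^2 <= ((1 + r)^2 / lm + theta) alpha T with T the
   preconditioned form; one alpha cancels when it is nonzero. *)
have := sqr_sum_le _ _ theta_ge0 _ x2 y2; rewrite -aE -mulrDr soras_form.
have p0 : 0 <= (1 + r) ^+ 2 / lm by rewrite divr_ge0 ?sqr_ge0 // ltW.
move=> /(_ p0 (mulr_ge0 a0 q0) (mulr_ge0 a0 (Phi_ge0 U))).
have T0 : 0 <= mxform A (P *m U) U + Phi U by rewrite addr_ge0 ?Phi_ge0.
move: (mxform A _ _ + Phi U) T0 => T T0 h.
rewrite /cT mulrAC ler_pdivrMr //.
have [->|an0] := eqVneq alpha 0.
  by rewrite mulr0 mulr_ge0 // ltW.
have agt0 : 0 < alpha by rewrite lt_neqAle eq_sym an0.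
have {}h : alpha <= ((1 + r) ^+ 2 / lm + theta) * T.
  by rewrite -(ler_pM2r agt0) -expr2 mulrAC -mulrA.
have := ler_wpM2l (ltW lm0) h; congr (_ <= _).
by field; rewrite gt_eqF.
Qed.

Lemma soras_bounds U :
  cT * mxform A U U <= mxform A (M *m A *m U) U
  /\ mxform A (M *m A *m U) U <= cR * mxform A U U.
Proof. by split; [exact: soras_lower|exact: soras_upper]. Qed.
End TwoLevel.

(** * The second eigenproblem and the projected local solve on one subdomain *)

Section Subdomain.
Variables (R : realType) (n : nat) (B xi eta C : 'M[R]_n).
Variables (S : {vspace 'cV[R]_n}) (p : nat).
Variables (Ug : 'I_p -> 'cV[R]_n) (mu : 'I_p -> R) (gamma : R).
Hypotheses (B_spd : spd B) (Cs : C^T = C).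
Hypothesis xi_proj : projection_on fullv S (orthv B S) xi.
Hypothesis Ug_basis : basis_of (orthv B S) [tuple Ug k | k < p].
Hypothesis Ug_eigen : forall k W, W \in orthv B S ->
  dot (C *m Ug k) W = mu k * dot (B *m Ug k) W.
Let H := (\sum_(k < p | (gamma < mu k)%R) <[Ug k]>)%VS.
Let L := (\sum_(k < p | (mu k <= gamma)%R) <[Ug k]>)%VS.
Hypothesis eta_proj : projection_on (orthv B S) H L eta.

Let Bpsd := spd_psd B_spd.

Lemma family_in_orthv k : Ug k \in orthv B S.
Proof.
rewrite -(span_basis Ug_basis) memv_span //.
by apply/tnthP; exists k; rewrite tnth_mktuple.
Qed.

Lemma family_eigen k l :
  mxform C (Ug k) (Ug l) = mu k * mxform B (Ug k) (Ug l).
Proof. by apply: Ug_eigen; exact: family_in_orthv. Qed.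

Lemma low_in_orthv u : u \in L -> u \in orthv B S.
Proof.
apply: subvP; apply/subv_sumP => k _; rewrite -memvE; exact: family_in_orthv.
Qed.

Lemma low_continuity u : u \in L -> mxform C u u <= gamma * mxform B u u.
Proof. exact: (low_form_le Cs Bpsd family_eigen). Qed.

Lemma xi_compl_in v : (1%:M - xi) *m v \in orthv B S.
Proof. by rewrite mulmxBl mul1mx; apply: (proj2 (xi_proj _)); exact: memvf. Qed.

Lemma eta_compl_in z : z \in orthv B S -> (1%:M - eta) *m z \in L.
Proof. by move=> zS; rewrite mulmxBl mul1mx; exact: (proj2 (eta_proj zS)). Qed.

Lemma eta_compl_dual u z : u \in L -> z \in orthv B S ->
  mxform B u ((1%:M - eta) *m z) = mxform B u z.
Proof.
move=> uL zS; rewrite mulmxBl mul1mx mxformBr.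
by rewrite (low_high_orth Cs Bpsd family_eigen uL (proj1 (eta_proj zS))) subr0.
Qed.

Lemma eta_compl_decr z : z \in orthv B S ->
  mxform B ((1%:M - eta) *m z) ((1%:M - eta) *m z) <= mxform B z z.
Proof.
move=> zS; have := low_form_decr Cs Bpsd family_eigen (eta_compl_in zS)
  (proj1 (eta_proj zS)).
by rewrite {3 4}mulmxBl mul1mx subrK.
Qed.

Lemma local_solve_in g :
  (1%:M - eta) *m (1%:M - xi) *m invmx B *m g \in L.
Proof.
rewrite -!mulmxA; apply: eta_compl_in; exact: xi_compl_in.
Qed.

(** Both projections are invisible to u in [L]: eta removes a component in [H] and xi one in [S],
    and [L] is B-orthogonal to each. There remains B(u, B^-1 g) = (u, g). *)
Lemma local_solve_dual u g : u \in L ->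
  mxform B u ((1%:M - eta) *m (1%:M - xi) *m invmx B *m g) = dot u g.
Proof.
move=> uL; rewrite -!mulmxA eta_compl_dual ?xi_compl_in //.
set v := invmx B *m g.
rewrite mulmxBl mul1mx mxformBr.
have -> : mxform B u (xi *m v) = 0.
  have /orthvP h := low_in_orthv uL; apply: h.
  by apply: (proj1 (xi_proj _)); exact: memvf.
by rewrite subr0 /mxform dot_mull (proj1 B_spd) mulKVmx // spd_unit.
Qed.
End Subdomain.

(** * The first eigenproblem and its stable local splitting *)

Section TauProblem.
Variables (R : realType) (n : nat) (B xi ANeu : 'M[R]_n).
Variables (V : 'I_n -> 'cV[R]_n) (lam : 'I_n -> R) (tau : R).
Hypotheses (B_spd : spd B) (ANeu_spd : spd ANeu).
Hypothesis V_basis : basis_of fullv [tuple V k | k < n].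
Hypothesis V_eigen : forall k,
  (1%:M - xi^T) *m B *m (1%:M - xi) *m V k = lam k *: (ANeu *m V k).
Hypothesis tau_ge0 : 0 <= tau.

(** The eigenvectors above tau make up h, the others y, and the two parts are ANeu-orthogonal, so
    the left side is at most tau ANeu(y,y) <= tau ANeu(x,x). *)
Lemma tau_split x : exists y h,
  [/\ x = y + h, h \in (\sum_(k < n | (tau < lam k)%R) <[V k]>)%VS
    & mxform B ((1%:M - xi) *m y) ((1%:M - xi) *m y) <= tau * mxform ANeu x x].
Proof.
have [y [h [yl hh ->]]] := basis_split_low_high lam tau V_basis (memvf x).
exists y, h; split=> //.
have XE : (1%:M - xi)^T = 1%:M - xi^T by rewrite linearB /= trmx1.
have Cs : ((1%:M - xi^T) *m B *m (1%:M - xi))^T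
  = (1%:M - xi^T) *m B *m (1%:M - xi).
  by rewrite !trmx_mul -XE trmxK (proj1 B_spd) mulmxA.
have eig k l : mxform ((1%:M - xi^T) *m B *m (1%:M - xi)) (V k) (V l)
    = lam k * mxform ANeu (V k) (V l).
  by rewrite /mxform V_eigen dotZl.
have Np := spd_psd ANeu_spd.
rewrite mxformM XE; apply: (le_trans (low_form_le Cs Np eig yl)).
by rewrite ler_wpM2l // (low_form_decr Cs Np eig yl hh).
Qed.
End TauProblem.

(** * Continuity and stability of the GenEO decomposition *)

Lemma diag_mx_tr (R : pzRingType) n (D : 'M[R]_n) : is_diag_mx D -> D^T = D.
Proof. by move=> /diag_mxP[e ->]; exact: tr_diag_mx. Qed.

Theorem mainTheorem4 (R : realType) (n N : nat)
  (* mesh elements, their degrees of freedom, element forms, global matrix *)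
  (T : finType) (dof : T -> {set 'I_n})
  (aK : T -> {biscalar 'cV[R]_n}) (A : 'M[R]_n)
  (aK_sym : forall K U V, aK K U V = aK K V U)
  (aK_psd : forall K U, 0 <= aK K U U)
  (aK_local : forall K (U U' V : 'cV[R]_n),
     (forall q, q \in dof K -> U q 0 = U' q 0) -> aK K U V = aK K U' V)
  (A_spd : spd A)
  (A_sum : forall U V, dot (A *m U) V = \sum_(K : T) aK K U V)
  (* subdomains *)
  (Om : 'I_N -> {set T}) (Om_cover : \bigcup_(i < N) Om i = [set: T])
  (d : 'I_N -> nat) (Rm : forall i, 'M[R]_(d i, n))
  (Rm_restr : forall i, restriction_mx (\bigcup_(K in Om i) dof K) (Rm i))
  (Dm : forall i, 'M[R]_(d i)) (Dm_diag : forall i, is_diag_mx (Dm i))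
  (Dm_unity : \sum_(i < N) (Rm i)^T *m Dm i *m Rm i = 1%:M)
  (ANeu : forall i, 'M[R]_(d i)) (ANeu_spd : forall i, spd (ANeu i))
  (ANeu_def : forall i (U V : 'cV[R]_n),
     dot (ANeu i *m (Rm i *m U)) (Rm i *m V) = \sum_(K in Om i) aK K U V)
  (* near-kernel, local matrices, projections onto G_i *)
  (G : {vspace 'cV[R]_n})
  (B : forall i, 'M[R]_(d i)) (B_spd : forall i, spd (B i))
  (xi : forall i, 'M[R]_(d i))
  (xi_proj : forall i,
     projection_on fullv (mximage (Rm i) G) (orthv (B i) (mximage (Rm i) G))
                   (xi i))
  (* first generalised eigenvalue problem *)
  (tau : R) (tau_gt0 : 0 < tau)
  (V : forall j, 'I_(d j) -> 'cV[R]_(d j)) (lam : forall j, 'I_(d j) -> R)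
  (V_basis : forall j, basis_of fullv [tuple V j k | k < d j])
  (V_eigen : forall j k,
     (1%:M - (xi j)^T) *m B j *m (1%:M - xi j) *m V j k
     = lam j k *: (ANeu j *m V j k))
  (* second generalised eigenvalue problem *)
  (gamma : R) (gamma_gt0 : 0 < gamma)
  (p : 'I_N -> nat)
  (Ug : forall i, 'I_(p i) -> 'cV[R]_(d i)) (mu : forall i, 'I_(p i) -> R)
  (Ug_basis : forall i,
     basis_of (orthv (B i) (mximage (Rm i) G)) [tuple Ug i k | k < p i])
  (Ug_eigen : forall i k (W : 'cV[R]_(d i)),
     W \in orthv (B i) (mximage (Rm i) G) ->
     dot (Dm i *m Rm i *m A *m (Rm i)^T *m Dm i *m Ug i k) W
     = mu i k * dot (B i *m Ug i k) W)
  (eta : forall i, 'M[R]_(d i))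
  (eta_proj : forall i,
     projection_on (orthv (B i) (mximage (Rm i) G))
                   (\sum_(k < p i | (gamma < mu i k)%R) <[Ug i k]>)%VS
                   (\sum_(k < p i | (mu i k <= gamma)%R) <[Ug i k]>)%VS
                   (eta i))
  (* coarse space, exact and inexact coarse matrices *)
  (m : nat) (Z : 'M[R]_(n, m))
  (Z_basis : basis_of (near_kernel_space Rm Dm G
                       + geneo_tau_space Rm Dm xi V lam tau
                       + geneo_gamma_space Rm Dm Ug mu gamma)%VS
                      [tuple col k Z | k < m])
  (Et : 'M[R]_m) (Et_spd : spd Et)
  (lp lm : R)
  (lp_max : largest_eigenvalue (Z^T *m A *m Z *m invmx Et) lp)
  (lm_min : smallest_eigenvalue (Z^T *m A *m Z *m invmx Et) lm) :
  let k0 : R := (max_neighbours A Rm)%:R in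
  let k1 : R := (max_multiplicity Om)%:R in
  let eps := Num.max `|1 - lm| `|1 - lp| in
  let cR := (k0 * gamma * (1 + eps ^+ 2) + lp
             + Num.sqrt ((k0 * gamma * (1 + eps ^+ 2) - lp) ^+ 2
                         + 4 * lp * k0 * gamma * eps ^+ 2)) / 2 in
  let cT := lm / ((1 + eps * Num.sqrt (k0 * k1 * tau * gamma)) ^+ 2
                  + lm * k1 * tau) in
  let a (U W : 'cV[R]_n) := dot (A *m U) W in
  let M := soras2 Rm Dm (coarse_projection Z Et A) A B xi eta in
  forall U : 'cV[R]_n,
    cT * a U U <= a (M *m A *m U) U /\ a (M *m A *m U) U <= cR * a U U.
Proof.
move=> k0 k1 eps cR cT a M U.
have Dt i : (Dm i)^T = Dm i by exact: diag_mx_tr.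
pose X i : 'M[R]_(n, d i) := (Rm i)^T *m Dm i.
have Xt i : (X i)^T = Dm i *m Rm i by rewrite trmx_mul trmxK Dt.
pose C i := Dm i *m Rm i *m A *m (Rm i)^T *m Dm i.
have CE i : (X i)^T *m A *m X i = C i by rewrite Xt mulmxA.
have Ct i : (C i)^T = C i.
  by rewrite /C !trmx_mul !trmxK Dt (proj1 A_spd) !mulmxA.
pose L i := (\sum_(k < p i | (mu i k <= gamma)%R) <[Ug i k]>)%VS.
pose Pi i := (1%:M - eta i) *m (1%:M - xi i) *m invmx (B i).
have Pi_in i g : Pi i *m g \in L i.
  exact: (local_solve_in (xi_proj i) (eta_proj i)).
have Pi_dual i u g : u \in L i -> mxform (B i) u (Pi i *m g) = dot u g.
  exact: (local_solve_dual (B_spd i) (Ct i) (xi_proj i) (Ug_basis i)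
    (Ug_eigen i) (eta_proj i)).
have B_psd i : psd (B i) by exact: spd_psd.
have A_psd : psd A by exact: spd_psd.
have k0_ge0 : 0 <= k0 by exact: ler0n.
have k1_ge0 : 0 <= k1 by exact: ler0n.
have kappa_ge0 : 0 <= k0 * gamma by rewrite mulr_ge0 // ltW.
have theta_ge0 : 0 <= k1 * tau by rewrite mulr_ge0 // ltW.
have [Z_range Z_inj] := basis_of_cols Z_basis.
have continuity (u : forall i, 'cV[R]_(d i)) : (forall i, u i \in L i) ->
    mxform A (\sum_i X i *m u i) (\sum_i X i *m u i)
    <= k0 * gamma * \sum_i mxform (B i) (u i) (u i).
  (* When R_j A R_i^T = 0 the vectors X_i u_i and X_j u_j are a-orthogonal, so k0 bounds the number
     of interacting subdomains; gamma comes from the second eigenproblem on [L i]. *)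
  move=> uL; pose nb i j := Rm j *m A *m (Rm i)^T != 0.
  have nb_sym : symmetric nb.
    move=> i j; rewrite /nb -(inj_eq trmx_inj) trmx0.
    by rewrite !trmx_mul trmxK (proj1 A_spd) mulmxA.
  have nb0 i j : ~~ nb i j -> mxform A (X i *m u i) (X j *m u j) = 0.
    move=> /negbNE/eqP h; rewrite /mxform dotC dot_mull Xt /X !mulmxA.
    by rewrite -2!(mulmxA (Dm j)) h mulmx0 !mul0mx dotC dot0l.
  have nbk i : (#|[set j | nb i j]| <= max_neighbours A Rm)%N.
    exact: (leq_bigmax i).
  apply: (le_trans (form_sum_neighbours A_psd nb_sym nb0 nbk)).
  rewrite -mulrA ler_wpM2l // mulr_sumr ler_sum // => i _.
  rewrite mxformM CE.
  exact: (low_continuity (B_spd i) (Ct i) (Ug_basis i) (Ug_eigen i)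
    (uL i)).
have stability W : exists u : forall i, 'cV[R]_(d i),
    [/\ forall i, u i \in L i,
        exists f, W = Z *m f + \sum_i X i *m u i
      & \sum_i mxform (B i) (u i) (u i) <= k1 * tau * mxform A W W].
  (* The witness is u_i = (I - eta_i)(I - xi_i) y_i, where y_i is the low part of R_i W in the first
     eigenproblem. *)
  have /fin_all_exists[y hy] i := tau_split (B_spd i) (ANeu_spd i) (V_basis i)
    (V_eigen i) (ltW tau_gt0) (Rm i *m W).
  pose z i := (1%:M - xi i) *m y i.
  have zS i : z i \in orthv (B i) (mximage (Rm i) G).
    exact: (xi_compl_in (xi_proj i)).
  exists (fun i => (1%:M - eta i) *m z i); split.
  - by move=> i; exact: (eta_compl_in (eta_proj i) (zS i)).
  - have [|f Wf] := Z_range (W - \sum_i X i *m ((1%:M - eta i) *m z i)).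
      (* The partition of unity writes W as sum_i X_i R_i W, so the remainder can be placed in the
         coarse space subdomain by subdomain. *)
      rewrite -{1}(mul1mx W) -Dm_unity mulmx_suml -sumrB.
      apply: memv_suml => i _; have [h [yh hh _]] := hy i.
      (* The three terms lie in V_G, in the tau space and in the gamma space respectively. *)
      have -> : (Rm i)^T *m Dm i *m Rm i *m W
          - X i *m ((1%:M - eta i) *m z i)
        = X i *m (xi i *m (Rm i *m W)) + X i *m ((1%:M - xi i) *m h)
          + X i *m (eta i *m z i).
        have er : Rm i *m W = xi i *m (Rm i *m W) + z i + (1%:M - xi i) *m h.
          rewrite /z -addrA -mulmxDr -yh mulmxBl mul1mx.
          by rewrite addrC subrK.
        rewrite -!mulmxDr -mulmxA -/(X i) -mulmxBr; congr (_ *m _).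
        rewrite {1}er [(1%:M - eta i) *m _]mulmxBl mul1mx opprB.
        by rewrite (addrAC _ (z i)) addrACA subrr addr0.
      apply: memvD; first apply: memvD.
      + apply: subvP (addvSl _ _) _ _; apply: subvP (addvSl _ _) _ _.
        apply: subvP (sumv_sup i _ (subvv _)) _ _ => //.
        apply/mximageP; exists (xi i *m (Rm i *m W)) => //.
        by apply: (proj1 (xi_proj i _ _)); exact: memvf.
      + apply: subvP (addvSl _ _) _ _; apply: subvP (addvSr _ _) _ _.
        apply: subvP (sumv_sup i _ (subvv _)) _ _ => //.
        have [c ->] := memv_sum_lineP hh.
        rewrite !mulmx_sumr; apply: memv_sumr => k kt.
        by apply/vlineP; exists (c k); rewrite -!scalemxAr !mulmxA.
      + apply: subvP (addvSr _ _) _ _.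
        apply: subvP (sumv_sup i _ (subvv _)) _ _ => //.
        have [c ->] := memv_sum_lineP (proj1 (eta_proj i _ (zS i))).
        rewrite !mulmx_sumr; apply: memv_sumr => k kt.
        by apply/vlineP; exists (c k); rewrite -scalemxAr.
    by exists f; rewrite -Wf subrK.
  - apply: (@le_trans _ _
      (tau * \sum_i mxform (ANeu i) (Rm i *m W) (Rm i *m W))).
      rewrite mulr_sumr ler_sum // => i _; have [h [_ _ hz]] := hy i.
      apply: le_trans hz.
      exact: (eta_compl_decr (B_spd i) (Ct i) (Ug_basis i) (Ug_eigen i)
        (eta_proj i) (zS i)).
    rewrite (mulrC k1) -mulrA ler_wpM2l ?(ltW tau_gt0) //.
    (* After exchanging the sums, the energy of element K is counted once per subdomain containing
       K, hence at most k1 times. *)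
    rewrite /mxform A_sum (eq_bigr _ (fun i _ => ANeu_def i W W)).
    rewrite (exchange_big_dep predT) //= mulr_sumr ler_sum // => K _.
    rewrite (eq_bigl (mem [set i | K \in Om i])); last by move=> i; rewrite !inE.
    rewrite sumr_const -mulr_natl ler_wpM2r // ler_nat.
    exact: (leq_bigmax K).
have := soras_bounds A_spd Z_inj Et_spd lp_max lm_min B_psd Pi_in Pi_dual
  kappa_ge0 theta_ge0 continuity stability U.
have -> : \sum_i X i *m Pi i *m (X i)^T = \sum_(i < N) (Rm i)^T *m Dm i
    *m (1%:M - eta i) *m (1%:M - xi i) *m invmx (B i) *m Dm i *m Rm i.
  by apply: eq_bigr => i _; rewrite Xt !mulmxA.
have -> : k0 * gamma * (k1 * tau) = k0 * k1 * tau * gamma by ring.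
by rewrite (mulrA lm) (mulrA (4 * lp)).
Qed.
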